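(* Let $e\ge 1$ be an integer and let $a,b\in\mathbb{N}$ be such that $a\le q-2$ and $0\le b-ea$. Set $$s:=\frac{b-q}{e},\qquad \widetilde{s}:=\begin{cases}\min\{\lfloor s\rfloor,a\} & \text{if } s\ge 0,\\ -1 & \text{otherwise.}\end{cases}$$ For every integer $d$ with $1+\widetilde{s}\le d\le a$ define the vector $$v_d:=(0,\alpha^{*(q-1-d)})\otimes(1,\alpha^{*(q-1-b+ed)})\in\mathbb{F}_q^{(q+1)^2}.$$ Define three codes of length $(q+1)^2$ by $$C_1:=\overline{C_{\mathbb{A},e}}\big((q-1)\sigma_e+(q-2-b)F_e\big),\qquad C_2:=\mathrm{PRS}_q(q-a)\otimes\mathbb{F}_q^{q+1},\qquad C_3:=\langle v_d \mid 1+\widetilde{s}\le d\le a\rangle .$$ Then the dual of $C_e(a,b)$ is $$C_e(a,b)^\perp=C_1+C_2+C_3 .$$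
   Context: $q$ is a prime power, $\mathbb{F}_q=\{\alpha_1,\dots,\alpha_q\}$ is the field with $q$ elements, $\mathbb{N}=\{0,1,2,\dots\}$, and $0^0:=1$. For $k\in\mathbb{N}$, $\alpha^{*k}:=(\alpha_1^k,\dots,\alpha_q^k)\in\mathbb{F}_q^q$. Duals are taken with respect to the standard (Euclidean) bilinear form; $\langle\cdot\rangle$ denotes linear span. Tensor products: for $C_1\subset\mathbb{F}_q^{n_1}$, $C_2\subset\mathbb{F}_q^{n_2}$, $C_1\otimes C_2$ is the space of $n_2\times n_1$ matrices whose rows lie in $C_1$ and whose columns lie in $C_2$; for vectors $u\in\mathbb{F}_q^{n_1}$, $v\in\mathbb{F}_q^{n_2}$, $u\otimes v$ is the matrix with $(i,j)$ entry $v_iu_j$. Words of length $(q+1)^2$ are regarded as $(q+1)\times(q+1)$ matrices. Projective Reed–Solomon codes: for $1\le k\le q+1$, $\mathrm{PRS}_q(k)\subset\mathbb{F}_q^{q+1}$ is the set of vectors $(P(0,1),P(1,\alpha_1),\dots,P(1,\alpha_q))$ with $P\in\mathbb{F}_q[X,Y]$ homogeneous of degree $k-1$ (or zero); $\mathrm{PRS}_q(k)=\{0\}$ for $k\le 0$ and $\mathrm{PRS}_q(k)=\mathbb{F}_q^{q+1}$ for $k\ge q+1$. The code $C_e(a,b)$: choose representatives of $\mathbb{P}^1(\mathbb{F}_q)$ in the order $(0,1),(1,\alpha_1),\dots,(1,\alpha_q)$. For integers $a,b$, let $L_*(aS_e+bF_e)$ be the $\mathbb{F}_q$-span of the monomials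 $X_1^{d_1}X_2^{d_2}T_1^{c_1}T_2^{c_2}$ with nonnegative exponents satisfying $d_1+d_2=a$ and $c_1+c_2-ed_1=b-ea$ (it is $\{0\}$ if there are none). The code $C_e(a,b)\subset\mathbb{F}_q^{(q+1)^2}$ is the set of matrices $\big(f(x_1,x_2,t_1,t_2)\big)$, $f\in L_*(aS_e+bF_e)$, with rows indexed by the representatives $(t_1,t_2)$ and columns by the representatives $(x_1,x_2)$ of $\mathbb{P}^1(\mathbb{F}_q)$. (This is the evaluation code on the $\mathbb{F}_q$-points of the Hirzebruch surface $\mathcal{H}_e$.) The code $C_{\mathbb{A},e}(a,b)\subset\mathbb{F}_q^{q^2}$ is obtained from $C_e(a,b)$ by deleting the first row and the first column of each codeword. $\overline{C_{\mathbb{A},e}}(a,b)\subset\mathbb{F}_q^{(q+1)^2}$ is the set of codewords of $C_{\mathbb{A},e}(a,b)$ extended by zeros on the first row and first column. For integers $a',b'$, $\overline{C_{\mathbb{A},e}}(a'\sigma_e+b'F_e):=\overline{C_{\mathbb{A},e}}(a',b'+ea')$. *)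

(* Defs.v *)
From HB Require Import structures.
From mathcomp Require Import all_boot all_order all_algebra.
From mathcomp Require Import boolp classical_sets.
From mathcomp Require Export mpoly.

Set Implicit Arguments.
Unset Strict Implicit.
Unset Printing Implicit Defensive.

Import Order.TTheory GRing.Theory Num.Theory.

Local Open Scope classical_set_scope.
Local Open Scope ring_scope.

Definition lspan (F : fieldType) (V : lmodType F) (A : set V) : set V :=
  [set v | exists (n : nat) (c : 'I_n -> F) (w : 'I_n -> V),
     (forall i, A (w i)) /\ v = \sum_(i < n) c i *: w i].

Definition set_add (V : zmodType) (A B : set V) : set V :=
  [set x + y | x in A & y in B].

Section Codes.

Variable F : fieldType.

Definition mxdot m n (M N : 'M[F]_(m, n)) : F :=
  \sum_(i < m) \sum_(j < n) M i j * N i j.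

Definition dual_code m n (C : set 'M[F]_(m, n)) : set 'M[F]_(m, n) :=
  [set M | forall N, C N -> mxdot M N = 0].

(* Rows lie in the first factor and columns in the second one. *)
Definition tensor_code n1 n2 (C1 : set 'rV[F]_n1) (C2 : set 'rV[F]_n2) :
    set 'M[F]_(n2, n1) :=
  [set M | (forall i, C1 (row i M)) /\ (forall j, C2 (col j M)^T)].

Definition tensor_vec n1 n2 (u : 'rV[F]_n1) (v : 'rV[F]_n2) :
    'M[F]_(n2, n1) :=
  \matrix_(i, j) (v 0 i * u 0 j).

(* alpha enumerates the elements of F, and q is their number. *)
Variables (q : nat) (alpha : 'I_q -> F).

(* alpha^{*k}; note that 0 ^+ 0 = 1. *)
Definition alpha_pow (k : nat) : 'rV[F]_q := \row_i alpha i ^+ k.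

(* Representatives of P^1(F): index 0 is (0, 1), and the i-th index after it
   is (1, alpha i). *)
Definition P1 (i : 'I_(1 + q)) : F * F :=
  match split i with
  | inl _ => (0, 1)
  | inr j => (1, alpha j)
  end.

Definition PRS_vec (P : {mpoly F[2]}) : 'rV[F]_(1 + q) :=
  \row_i P.@[fun k : 'I_2 => [:: (P1 i).1; (P1 i).2]`_k].

Definition PRS (k : int) : set 'rV[F]_(1 + q) :=
  if (k <= 0)%R then [set 0]
  else if (q%:Z + 1 <= k)%R then setT
  else [set PRS_vec P | P in [set P : {mpoly F[2]} | P \is (`|k|%N.-1).-homog]].

(* The variables X_1, X_2, T_1, T_2 have the indices 0, 1, 2, 3. *)
Definition Lstar_mon (e : nat) (a b : int) (m : 'X_{1..4}) : Prop :=
  let d1 := (m (inord 0))%:Z in let d2 := (m (inord 1))%:Z in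
  let c1 := (m (inord 2))%:Z in let c2 := (m (inord 3))%:Z in
  d1 + d2 = a /\ c1 + c2 - e%:Z * d1 = b - e%:Z * a.

(* L_*(a S_e + b F_e) *)
Definition Lstar (e : nat) (a b : int) : set {mpoly F[4]} :=
  lspan [set 'X_[m] | m in [set m | Lstar_mon e a b m]].

Definition Hirz_eval (f : {mpoly F[4]}) : 'M[F]_(1 + q) :=
  \matrix_(i, j)
    f.@[fun k : 'I_4 => [:: (P1 j).1; (P1 j).2; (P1 i).1; (P1 i).2]`_k].

Definition Hirz_code (e : nat) (a b : int) : set 'M[F]_(1 + q) :=
  [set Hirz_eval f | f in Lstar e a b].

(* drsubmx removes the first row and the first column. *)
Definition aff_code (e : nat) (a b : int) : set 'M[F]_q :=
  [set drsubmx M | M in Hirz_code e a b].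

Definition aff_ext_code (e : nat) (a b : int) : set 'M[F]_(1 + q) :=
  [set block_mx 0 0 0 N | N in aff_code e a b].

(* The code attached to a sigma_e + b F_e. *)
Definition aff_ext_code_sigma (e : nat) (a b : int) : set 'M[F]_(1 + q) :=
  aff_ext_code e a (b + e%:Z * a).

Definition slope (e b : nat) : rat := (b%:R - q%:R) / e%:R.

Definition stilde (e a b : nat) : int :=
  if (0 <= slope e b)%R then Num.min (Num.floor (slope e b)) a%:Z else - 1.

(* Used for 1 + stilde e a b <= d <= a <= q - 2, where both exponents are
   nonnegative and the subtractions are not truncated. *)
Definition vec_d (e b d : nat) : 'M[F]_(1 + q) :=
  tensor_vec (row_mx 0 (alpha_pow (q - 1 - d)))
             (row_mx 1%:M (alpha_pow (q - 1 + e * d - b))).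

Definition code1 (e b : nat) : set 'M[F]_(1 + q) :=
  aff_ext_code_sigma e (q%:Z - 1) (q%:Z - 2 - b%:Z).

Definition code2 (a : nat) : set 'M[F]_(1 + q) :=
  tensor_code (PRS (q%:Z - a%:Z)) setT.

Definition code3 (e a b : nat) : set 'M[F]_(1 + q) :=
  lspan [set vec_d e b d | d in
    [set d : nat | (1 + stilde e a b <= d%:Z)%R /\ (d <= a)%N]].

End Codes.

(* Main.v *)
(* Write u_(n,c) for the vector of values of X^(n-c) Y^c on P^1(F_q), and
   n_d = b - ed. The code C_e(a,b) is spanned by the u_(a,d) (x) u_(n_d,c) with
   d <= a and c <= n_d, so M lies in its dual iff every w_d = M u_(a,d) is
   orthogonal to PRS_q(n_d + 1), i.e. w_d is in PRS_q(q - n_d). By the values of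
   the power sums over F_q, the vectors (0, alpha^(q-1-d)) are, up to sign, dual
   to the u_(a,d), so that subtracting
   N = - sum_d (0, alpha^(q-1-d)) (x) w_d from M kills all the M u_(a,d), which
   means that M - N lies in PRS_q(q-a) (x) F_q^(q+1). Expanding w_d in the
   u_(q-1-n_d,c), the terms c < q-1-n_d of N vanish at infinity and lie in C_1,
   and the term c = q-1-n_d, present exactly when d > s, is a multiple of v_d. *)
Require Import Defs.
From mathcomp Require Import all_boot all_order all_algebra.
From mathcomp Require Import finfield.
From mathcomp Require Import boolp classical_sets.
From mathcomp Require Import zify.

Set Implicit Arguments.
Unset Strict Implicit.
Unset Printing Implicit Defensive.

Import Order.TTheory GRing.Theory Num.Theory.

Local Open Scope classical_set_scope.
Local Open Scope ring_scope.

(** * Linear subspaces and spans, as sets of vectors *)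

Section Subspaces.

Variables (F : fieldType) (V : lmodType F).
Implicit Types A B : set V.

Definition subspace A := A 0 /\ forall k x y, A x -> A y -> A (k *: x + y).

Lemma subspaceD A x y : subspace A -> A x -> A y -> A (x + y).
Proof. by move=> [_ AD] Ax Ay; rewrite -[x]scale1r; apply: AD. Qed.

Lemma subspace_sum A (I : finType) (v : I -> V) :
  subspace A -> (forall i, A (v i)) -> A (\sum_i v i).
Proof.
by move=> sA Av; apply: big_ind => [|x y|i _]; [case: sA|exact: subspaceD|].
Qed.

Lemma subspaceZ A k x : subspace A -> A x -> A (k *: x).
Proof. by move=> [A0 AD] Ax; rewrite -[k *: x]addr0; apply: AD. Qed.

Lemma subset_lspan A : A `<=` lspan A.
Proof.
move=> x Ax; exists 1%N, (fun=> 1), (fun=> x); split=> //.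
by rewrite big_ord1 scale1r.
Qed.

Lemma lspan_min A B : subspace B -> A `<=` B -> lspan A `<=` B.
Proof.
move=> sB AB _ [n [c [w [Aw ->]]]]; apply: subspace_sum => // i.
by apply: subspaceZ => //; apply/AB/Aw.
Qed.

Lemma subspace_lspan A : subspace (lspan A).
Proof.
split; first by exists 0%N, (fun=> 0), (fun=> 0); split=> [[]//|]; rewrite big_ord0.
move=> k _ _ [n [c [w [Aw ->]]]] [n' [c' [w' [Aw' ->]]]].
(* Two linear combinations are merged by concatenating their index sets. *)
exists (n + n')%N, (fun i => match split i with inl j => k * c j | inr j => c' j end),
  (fun i => match split i with inl j => w j | inr j => w' j end); split.
  by move=> i; case: split.
rewrite big_split_ord scaler_sumr; congr (_ + _); apply: eq_bigr => i _.
  by rewrite (unsplitK (inl i)) scalerA.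
by rewrite (unsplitK (inr i)).
Qed.

Lemma subspace_set_add A B : subspace A -> subspace B -> subspace (set_add A B).
Proof.
move=> [A0 AD] [B0 BD]; split; first by exists 0 => //; exists 0 => //; rewrite addr0.
move=> k _ _ [x Ax [y By <-]] [x' Ax' [y' By' <-]].
exists (k *: x + x'); first exact: AD.
by exists (k *: y + y'); [exact: BD|rewrite scalerDr addrACA].
Qed.

End Subspaces.

Lemma linear_fun0 (F : fieldType) (V W : lmodType F) (f : V -> W) :
  linear f -> f 0 = 0.
Proof. by move=> lf; have := lf (-1) 0 0; rewrite scaler0 addr0 scaleN1r addNr. Qed.

Lemma lspan_image (F : fieldType) (V W : lmodType F) (f : V -> W) (A : set V) :
  linear f -> f @` lspan A = lspan (f @` A).
Proof.
move=> lf; have [A0 AD] := subspace_lspan A; have [B0 BD] := subspace_lspan (f @` A).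
have f0 := linear_fun0 lf; apply/seteqP; split.
  apply/image_subP; apply: (@lspan_min _ _ _ [set x | lspan (f @` A) (f x)]).
    by split=> [|k x y Ax Ay] /=; rewrite ?f0 ?lf //; apply: BD.
  by move=> x Ax; apply: subset_lspan; exists x.
apply: lspan_min => [|_ [x Ax <-]]; last by exists x => //; apply: subset_lspan.
split; first by exists 0.
by move=> k _ _ [x Ax <-] [y Ay <-]; exists (k *: x + y); [exact: AD|exact: lf].
Qed.

(** * The bilinear form on matrices, tensors and duals *)

Section Dot.

Variable F : fieldType.

Lemma mxdotC m n (M N : 'M[F]_(m, n)) : mxdot M N = mxdot N M.
Proof. by apply: eq_bigr => i _; apply: eq_bigr => j _; rewrite mulrC. Qed.

Lemma mxdotDl m n k (M M' N : 'M[F]_(m, n)) :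
  mxdot (k *: M + M') N = k * mxdot M N + mxdot M' N.
Proof.
rewrite /mxdot mulr_sumr -big_split; apply: eq_bigr => i _ /=.
rewrite mulr_sumr -big_split; apply: eq_bigr => j _ /=.
by rewrite !mxE mulrDl mulrA.
Qed.

Lemma mxdot0l m n (N : 'M[F]_(m, n)) : mxdot 0 N = 0.
Proof. by apply: big1 => i _; apply: big1 => j _; rewrite mxE mul0r. Qed.

Lemma mxdot_row n (u v : 'rV[F]_n) : mxdot u v = \sum_j u 0 j * v 0 j.
Proof. by rewrite /mxdot big_ord1. Qed.

Lemma mxdot_row_mx n1 n2 (u u' : 'rV[F]_n1) (v v' : 'rV[F]_n2) :
  mxdot (row_mx u v) (row_mx u' v') = mxdot u u' + mxdot v v'.
Proof.
rewrite !mxdot_row big_split_ord /=.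
by congr (_ + _); apply: eq_bigr => i _; rewrite ?row_mxEl ?row_mxEr.
Qed.

(** Here [u *m M^T] is M applied to u, written as a row: orthogonality to a tensor becomes a
    condition on vectors. *)
Lemma mxdot_tensor m n (M : 'M[F]_(m, n)) u v :
  mxdot M (tensor_vec u v) = mxdot (u *m M^T) v.
Proof.
rewrite mxdot_row; apply: eq_bigr => i _.
rewrite mxE mulr_suml; apply: eq_bigr => j _.
by rewrite !mxE [v 0 i * _]mulrC mulrA [M i j * _]mulrC.
Qed.

Lemma mulmx_tensor m n (u u' : 'rV[F]_n) (v : 'rV[F]_m) :
  u' *m (tensor_vec u v)^T = mxdot u u' *: v.
Proof.
apply/rowP=> i; rewrite !mxE mxdot_row mulr_suml; apply: eq_bigr => j _.
by rewrite !mxE [v 0 i * _]mulrC mulrA [u' 0 j * _]mulrC.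
Qed.

Lemma mxdotZl m n k (M N : 'M[F]_(m, n)) : mxdot (k *: M) N = k * mxdot M N.
Proof. by rewrite -[k *: M]addr0 mxdotDl mxdot0l addr0. Qed.

Lemma subspace_dual m n (C : set 'M[F]_(m, n)) : subspace (dual_code C).
Proof.
split=> [N _|k M M' CM CM' N CN]; first exact: mxdot0l.
by rewrite mxdotDl CM // CM' // mulr0 addr0.
Qed.

(** The vectors orthogonal to a fixed M form a subspace, so it is enough to test M on generators. *)
Lemma dual_lspan m n (A : set 'M[F]_(m, n)) : dual_code (lspan A) = dual_code A.
Proof.
apply/seteqP; split=> M AM N AN; first exact/AM/subset_lspan.
have sM : subspace [set N | mxdot M N = 0].
  split=> [/=|k x y /= Mx My]; rewrite mxdotC ?mxdot0l //.
  by rewrite mxdotDl mxdotC Mx mxdotC My mulr0 addr0.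
exact: (lspan_min sM AM).
Qed.

End Dot.

(** * Power sums and interpolation over a finite field *)

Section PowerSums.

Variable F : finFieldType.
Local Notation q := #|F|.

Lemma natr_card_finField : q%:R = 0 :> F.
Proof.
(* Translating by 1 the sum of all the elements adds q to it. *)
have /eqP : \sum_(x : F) x = \sum_(x : F) (x + 1).
  exact: (reindex_inj (addIr 1)).
by rewrite big_split sumr_const -[X in X == _]addr0 (inj_eq (addrI _)) => /eqP.
Qed.

Lemma expf_cardB1 (x : F) : x != 0 -> x ^+ (q - 1) = 1.
Proof.
move=> x0; apply: (mulfI x0); rewrite mulr1 -exprS.
by rewrite -[in RHS](expf_card x) subn1 prednK // ltnW // finNzRing_gt1.
Qed.

(** For k = 0 the sum is q = 0. For k > 0, the substitution x -> gx multiplies the sum by g^k, so a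
    g with g^k distinct from 1 makes it vanish. *)
Lemma sum_expf_small k : (k < q - 1)%N -> \sum_(x : F) x ^+ k = 0.
Proof.
case: k => [|k] hk.
  rewrite (eq_bigr (fun=> 1)) => [|i _]; last by rewrite expr0.
  by rewrite sumr_const natr_card_finField.
have [g /andP[g0 gk]] : exists g : F, (g != 0) && (g ^+ k.+1 != 1).
  (* Otherwise X^k - 1 would have q-1 roots, more than its degree. *)
  apply/existsP; rewrite -[[exists _, _]]negbK negb_exists; apply/negP => /forallP H.
  have P0 : 'X^(k.+1) - 1%:P != 0 :> {poly F}.
    by rewrite -size_poly_eq0 size_XnsubC.
  have roots : all (root ('X^(k.+1) - 1%:P)) (enum [pred x : F | x != 0]).
    apply/allP => x; rewrite mem_enum inE => x0.
    by rewrite rootE !hornerE subr_eq0; have := H x; rewrite x0 negbK.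
  have := max_poly_roots P0 roots (enum_uniq _).
  by rewrite size_XnsubC // -cardE (cardC1 (0 : F)) -subn1 ltnNge hk.
have /eqP : \sum_(x : F) x ^+ k.+1 = g ^+ k.+1 * \sum_(x : F) x ^+ k.+1.
  rewrite mulr_sumr [LHS](reindex_inj (mulfI g0)).
  by apply: eq_bigr => x _; rewrite exprMn.
rewrite -subr_eq0 -{1}[\sum_x _]mul1r -mulrBl mulf_eq0 subr_eq0 eq_sym.
by rewrite (negPf gk) => /eqP.
Qed.

(** Below 2(q-1), the only positive multiple of q-1 is q-1 itself; there each nonzero x contributes
    1, and q - 1 = -1 in F. *)
Lemma sum_expf k : (k < (q - 1).*2)%N ->
  \sum_(x : F) x ^+ k = - (k == q - 1)%N%:R.
Proof.
have q1 := finNzRing_gt1 F; move=> hk.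
have [kq|kq|kq] := ltngtP k (q - 1)%N; first by rewrite sum_expf_small // oppr0.
  (* Lowering the exponent by q-1 is harmless at x = 0 too, since the new exponent is still
     positive. *)
  rewrite oppr0 -[RHS](@sum_expf_small (k - (q - 1))); last by lia.
  apply: eq_bigr => x _; have [->|x0] := eqVneq x 0.
    by rewrite !expr0n; congr (_%:R); lia.
  by rewrite -{1}(subnK (ltnW kq)) exprD expf_cardB1 // mulr1.
rewrite kq (bigD1 0) //= expr0n (_ : (q - 1 == 0)%N = false); last by lia.
rewrite add0r (eq_bigr (fun=> 1)) => [|x x0]; last exact: expf_cardB1.
rewrite sumr_const (cardC1 (0 : F)) -subn1 natrB; last exact: ltnW.
by rewrite natr_card_finField sub0r.
Qed.

(** For distinct x and y, multiplication by x - y telescopes the sum to x^q - y^q = x - y. For x = y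
    it is q x^(q-1) = 0. *)
Lemma sum_expf_mul (x y : F) :
  \sum_(c < q) x ^+ (q - 1 - c) * y ^+ c = 1 - (x == y)%:R.
Proof.
have q1 := finNzRing_gt1 F.
have [<-|xy] := eqVneq x y.
  rewrite subrr (eq_bigr (fun=> x ^+ (q - 1))) => [|c _].
    by rewrite sumr_const card_ord -mulr_natr natr_card_finField mulr0.
  by rewrite -exprD subnK //; have := ltn_ord c; lia.
apply: (mulfI (x := x - y)); first by rewrite subr_eq0.
by rewrite subr0 mulr1 subn1 -subrXX !expf_card.
Qed.

(** Lagrange interpolation with the moments of f as coefficients: the indicator of x = y in f(y) =
    sum_x f(x) [x = y] is expanded by [sum_expf_mul]. *)
Lemma finField_interpolation (f : F -> F) y :
  f y = \sum_x f x - \sum_(c < q) (\sum_x f x * x ^+ (q - 1 - c)) * y ^+ c.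
Proof.
transitivity (\sum_x f x * (x == y)%:R).
  by rewrite (bigD1 y) //= eqxx mulr1 big1 ?addr0 // => x /negPf->; rewrite mulr0.
apply/eqP; rewrite eq_sym subr_eq addrC -subr_eq; apply/eqP.
rewrite -sumrB (eq_bigr (fun x => \sum_(c < q) f x * (x ^+ (q - 1 - c) * y ^+ c))).
  by rewrite exchange_big /=; apply: eq_bigr => c _; rewrite mulr_suml;
    apply: eq_bigr => x _; rewrite mulrA.
by move=> x _; rewrite -mulr_sumr sum_expf_mul mulrBr mulr1.
Qed.

End PowerSums.

(** * Monomial vectors on the projective line and their orthogonality *)

Section Codes.

Variables (F : finFieldType) (q : nat) (hq : #|F| = q).
Variables (alpha : 'I_q -> F) (halpha : bijective alpha).

Let q_gt1 : (1 < q)%N.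
Proof. by rewrite -hq finNzRing_gt1. Qed.

Let sum_alpha (f : F -> F) : \sum_i f (alpha i) = \sum_x f x.
Proof. by rewrite [RHS](reindex alpha) //; exact: onW_bij. Qed.

(* The values of X^(n-c) Y^c at the representatives of P^1, for c <= n. *)
Definition monvec (n c : nat) : 'rV[F]_(1 + q) :=
  row_mx (c == n)%:R%:M (alpha_pow alpha c).

Lemma P1l j : P1 alpha (lshift q j) = (0, 1).
Proof. by rewrite /P1 (unsplitK (inl j)). Qed.

Lemma P1r j : P1 alpha (rshift 1 j) = (1, alpha j).
Proof. by rewrite /P1 (unsplitK (inr j)). Qed.

Lemma monvecE n c i : (c <= n)%N ->
  monvec n c 0 i = (P1 alpha i).1 ^+ (n - c) * (P1 alpha i).2 ^+ c.
Proof.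
move=> cn; case: (fintype.splitP i) => j ij.
  rewrite (_ : i = lshift q j); last exact: val_inj.
  rewrite P1l row_mxEl !ord1 mxE eqxx mulr1n expr1n mulr1 expr0n subn_eq0.
  by rewrite eqn_leq cn.
rewrite (_ : i = rshift 1 j); last exact: val_inj.
by rewrite P1r row_mxEr mxE expr1n mul1r.
Qed.

Lemma mxdot_alpha_pow c c' :
  mxdot (alpha_pow alpha c) (alpha_pow alpha c') = \sum_(x : F) x ^+ (c + c').
Proof.
rewrite mxdot_row -sum_alpha; apply: eq_bigr => i _.
by rewrite !mxE exprD.
Qed.

Lemma mxdot_monvec n c n' c' :
  mxdot (monvec n c) (monvec n' c') =
  ((c == n) && (c' == n'))%N%:R + \sum_(x : F) x ^+ (c + c').
Proof.
rewrite mxdot_row_mx mxdot_alpha_pow; congr (_ + _).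
by rewrite mxdot_row big_ord1 !mxE !eqxx !mulr1n -natrM mulnb.
Qed.

(** The power sum is -1 exactly when c + c' = q-1, that is c = n and c' = n', and then the point at
    infinity contributes a compensating 1. *)
Lemma mxdot_monvec0 n c n' c' : (c <= n)%N -> (c' <= n')%N -> (n + n' = q - 1)%N ->
  mxdot (monvec n c) (monvec n' c') = 0.
Proof.
move=> cn cn' nq; rewrite mxdot_monvec sum_expf hq; last by lia.
by rewrite (_ : (_ && _) = (c + c' == q - 1)%N) ?subrr //; lia.
Qed.

Lemma mxdot0_alpha_pow c n' c' : (c + c' < q - 1)%N ->
  mxdot (row_mx 0 (alpha_pow alpha c)) (monvec n' c') = 0.
Proof.
move=> nq; rewrite mxdot_row_mx mxdot0l add0r mxdot_alpha_pow.
by rewrite sum_expf_small // hq.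
Qed.

(** The bound on a keeps the exponent q-1-d+d' below 2(q-1), so that only d = d' gives a nonzero
    power sum. *)
Lemma mxdot_alpha_pow_monvec a d d' : (a <= q - 2)%N -> (d <= q - 1)%N -> (d' <= a)%N ->
  mxdot (row_mx 0 (alpha_pow alpha (q - 1 - d))) (monvec a d') = - (d == d')%:R.
Proof.
move=> aq dq da; rewrite mxdot_row_mx mxdot0l add0r mxdot_alpha_pow.
by rewrite sum_expf hq; [congr (- _%:R)|]; lia.
Qed.

(* The dual of PRS_q(n+1) is contained in PRS_q(q-n). *)
Lemma monvec_dual n (w : 'rV[F]_(1 + q)) :
  (forall c, (c <= n)%N -> mxdot w (monvec n c) = 0) ->
  exists f : nat -> F, w = \sum_(c < q - n) f c *: monvec (q - 1 - n) c.
Proof.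
move=> wn; pose r := rsubmx w.
(* Away from infinity, w is read as a function [f] on F, with moments [S k]. The hypothesis makes
   the moments below n vanish and ties [S n] to the entry at infinity. *)
have [g ag _] := halpha.
pose f x := r 0 (g x).
have fr j : r 0 j = f (alpha j) by rewrite /f ag.
pose S k := \sum_x f x * x ^+ k.
have wS c : mxdot w (monvec n c) = w 0 (lshift q 0) * (c == n)%:R + S c.
  rewrite -[w]hsubmxK mxdot_row_mx mxdot_row big_ord1 row_mxEl !mxE eqxx mulr1n.
  congr (_ + _); rewrite mxdot_row /S -sum_alpha; apply: eq_bigr => j _.
  by rewrite fr !mxE.
have S0 c : (c < n)%N -> S c = 0.
  move=> cn; have := wn c (ltnW cn); by rewrite wS (ltn_eqF cn) mulr0 add0r.
have Sn : S n = - w 0 (lshift q 0).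
  by apply/eqP; rewrite -addr_eq0 addrC; have := wn n (leqnn n); rewrite wS eqxx mulr1 => ->.
(* These are the coefficients of the interpolation formula, the sum of all values of [f] being put
   into the constant one. *)
pose h c := (c == 0)%N%:R * S 0%N - S (q - 1 - c)%N.
have fE y : f y = \sum_(c < q) h c * y ^+ c.
  rewrite finField_interpolation hq.
  rewrite [RHS](eq_bigr (fun c : 'I_q => ((c : nat) == 0%N)%:R * S 0%N * y ^+ c -
     (\sum_x f x * x ^+ (q - 1 - c)) * y ^+ c)) => [|c _]; last first.
    by rewrite /h mulrBl.
  rewrite sumrB; congr (_ - _).
  rewrite (bigD1 (Ordinal (ltnW q_gt1))) //= mul1r expr0 mulr1 [X in _ + X]big1 ?addr0.
    by apply: eq_bigr => x _; rewrite expr0 mulr1.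
  by move=> c; rewrite -val_eqE /= => /negPf->; rewrite !mul0r.
(* The moment index q-1-c is then below n. If c = 0, then n >= q > 0, so [S 0] vanishes as well. *)
have h0 c : (c < q)%N -> (q - n <= c)%N -> h c = 0.
  rewrite /h => cq nc; rewrite (S0 (q - 1 - c)%N) ?subr0; last by lia.
  case: c cq nc => [|c] cq nc; last by rewrite mul0r.
  by rewrite S0 ?mulr0 //; lia.
exists h; rewrite -[LHS]hsubmxK.
have -> : \sum_(c < q - n) h c *: monvec (q - 1 - n) c =
  row_mx (\sum_(c < q - n) h c *: ((c : nat) == (q - 1 - n)%N)%:R%:M)
         (\sum_(c < q - n) h c *: alpha_pow alpha c).
  apply/rowP=> i; rewrite summxE.
  case: (fintype.splitP i) => j ij.
    rewrite (_ : i = lshift q j); last exact: val_inj.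
    rewrite row_mxEl summxE; apply: eq_bigr => c _.
    by rewrite [LHS]mxE [RHS]mxE row_mxEl.
  rewrite (_ : i = rshift 1 j); last exact: val_inj.
  rewrite row_mxEr summxE; apply: eq_bigr => c _.
  by rewrite [LHS]mxE [RHS]mxE row_mxEr.
congr row_mx; apply/rowP=> j; rewrite summxE.
  rewrite mxE !ord1.
  have [qn|nq] := leqP q n.
    (* The sum is empty here; all [h c] vanish, so [f] is zero, and so is the entry at infinity,
       which is [- S n]. *)
    rewrite (_ : (q - n = 0)%N); last by lia.
    rewrite big_ord0; apply/eqP; rewrite -oppr_eq0 -Sn; apply/eqP.
    rewrite /S big1 // => x _; rewrite fE big1 ?mul0r // => c _.
    by rewrite h0 ?mul0r //; lia.
  (* Only the top monomial is nonzero at infinity, and its coefficient is [- S n]. If it is also the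
     constant term, then n = q-1 > 0 and the extra [S 0] is zero. *)
  have lt : (q - 1 - n < q - n)%N by lia.
  rewrite (bigD1 (Ordinal lt)) //= !mxE !eqxx !mulr1n mulr1 big1 ?addr0.
    rewrite /h (_ : (q - 1 - (q - 1 - n) = n)%N); last by lia.
    rewrite Sn opprK; case: eqP => [E|_]; last by rewrite mul0r add0r.
    by rewrite S0 ?mulr0 ?add0r //; lia.
  by move=> c; rewrite -val_eqE !mxE /= => /negPf->; rewrite mul0rn mulr0.
rewrite fr fE (eq_bigr (fun c : 'I_(q - n) => h c * alpha j ^+ c)); last first.
  by move=> c _; rewrite !mxE.
rewrite [RHS](big_ord_widen q (fun c => h c * alpha j ^+ c)) ?leq_subr //.
rewrite [LHS](bigID (fun c : 'I_q => (c < q - n)%N)) /= [X in _ + X]big1 ?addr0 //.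
by move=> c nc; rewrite h0 ?mul0r // leqNgt.
Qed.

(** * Monomial generators of the codes *)

Lemma PRS_vec_linear : linear (PRS_vec alpha).
Proof. by move=> k f g; apply/rowP=> i; rewrite !mxE mevalD mevalZ. Qed.

Lemma Hirz_eval_linear : linear (Hirz_eval alpha).
Proof. by move=> k f g; apply/matrixP=> i j; rewrite !mxE mevalD mevalZ. Qed.

Lemma PRS_vec_mon (m : 'X_{1..2}) :
  PRS_vec alpha 'X_[m] = monvec (mdeg m) (m ord_max).
Proof.
have l1 : lift ord0 ord0 = ord_max :> 'I_2 by exact: val_inj.
apply/rowP=> i; rewrite monvecE; last by rewrite mdegE (bigD1 ord_max) //= leq_addr.
rewrite mxE mevalX !big_ord_recl big_ord0 mulr1 l1 mdegE !big_ord_recl big_ord0 l1 /=.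
by rewrite addn0 addnK.
Qed.

Lemma Hirz_eval_mon (m : 'X_{1..4}) :
  Hirz_eval alpha 'X_[m] =
  tensor_vec (monvec (m (inord 0) + m (inord 1))%N (m (inord 1)))
             (monvec (m (inord 2) + m (inord 3))%N (m (inord 3))).
Proof.
have E0 : ord0 = inord 0 :> 'I_4 by apply: val_inj; rewrite /= inordK.
have E1 : lift ord0 ord0 = inord 1 :> 'I_4 by apply: val_inj; rewrite /= inordK.
have E2 : lift ord0 (lift ord0 ord0) = inord 2 :> 'I_4 by apply: val_inj; rewrite /= inordK.
have E3 : lift ord0 (lift ord0 (lift ord0 ord0)) = inord 3 :> 'I_4.
  by apply: val_inj; rewrite /= inordK.
apply/matrixP=> i j; rewrite [LHS]mxE [RHS]mxE !monvecE ?leq_addl // !addnK mevalX.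
rewrite !big_ord_recl big_ord0 mulr1 -E0 -E1 -E2 -E3 /=.
by rewrite mulrA mulrC.
Qed.

Lemma Hirz_codeE e a b : Hirz_code alpha e a b =
  lspan [set Hirz_eval alpha 'X_[m] | m in Lstar_mon e a b].
Proof.
rewrite /Hirz_code /Lstar lspan_image; last exact: Hirz_eval_linear.
by rewrite image_comp.
Qed.

Definition mnm4 (d1 d2 c1 c2 : nat) : 'X_{1..4} := [multinom [tuple d1; d2; c1; c2]].

Lemma mnm4E d1 d2 c1 c2 (m := mnm4 d1 d2 c1 c2) :
  [/\ m (inord 0) = d1, m (inord 1) = d2, m (inord 2) = c1 & m (inord 3) = c2].
Proof. by rewrite /m !multinomE !(tnth_nth 0%N) !inordK. Qed.

(** With d and c the exponents of X_2 and T_2, that of X_1 is a - d, which forces total degree b -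
    ed in T_1, T_2. As ea <= b, no subtraction is truncated. *)
Lemma dual_Hirz_codeP e a b (M : 'M[F]_(1 + q)) : (e * a <= b)%N ->
  dual_code (Hirz_code alpha e a b) M <->
  (forall d c, (d <= a)%N -> (c <= b - e * d)%N ->
     mxdot M (tensor_vec (monvec a d) (monvec (b - e * d) c)) = 0).
Proof.
move=> eab; rewrite Hirz_codeE dual_lspan; split=> [H d c da cb|H _ [m [m1 m2] <-]].
  have ed : (e * d <= e * a)%N by rewrite leq_mul2l da orbT.
  have [E0 E1 E2 E3] := mnm4E (a - d) d (b - e * d - c) c.
  have := H (Hirz_eval alpha 'X_[mnm4 (a - d) d (b - e * d - c) c]).
  rewrite Hirz_eval_mon E0 E1 E2 E3 !subnK //; apply.
  rewrite -[X in tensor_vec (monvec X _)](subnK da) -[X in tensor_vec _ (monvec X _)](subnK cb).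
  exists (mnm4 (a - d) d (b - e * d - c) c); last by rewrite Hirz_eval_mon E0 E1 E2 E3.
  by rewrite /Lstar_mon E0 E1 E2 E3; split; nia.
rewrite Hirz_eval_mon.
have -> : (m (inord 0) + m (inord 1))%N = a by lia.
have -> : (m (inord 2) + m (inord 3) = b - e * m (inord 1))%N by nia.
by apply: H; nia.
Qed.

(** This form gives access to block products and to linearity in each factor. *)
Lemma tensor_vecE n1 n2 (u : 'rV[F]_n1) (v : 'rV[F]_n2) : tensor_vec u v = v^T *m u.
Proof. by apply/matrixP=> i j; rewrite !mxE big_ord1 !mxE. Qed.

Lemma code1E e b : code1 alpha e b = lspan
  [set (tensor_vec (row_mx 0 (alpha_pow alpha (q - 1 - p.1)))
                   (row_mx 0 (alpha_pow alpha p.2)) : 'M[F]_(1 + q))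
     | p in [set p : nat * nat | (p.1 <= q - 1)%N /\ (p.2 + b + 2 <= q + e * p.1)%N]].
Proof.
(* Deletion followed by extension by zero is one linear map, so it commutes with spans. *)
pose ext (M : 'M[F]_(1 + q)) : 'M[F]_(1 + q) := block_mx 0 0 0 (drsubmx M).
have ext_linear : linear ext.
  move=> k M N; rewrite /ext scale_block_mx add_block_mx !scaler0 !addr0.
  by congr block_mx; apply/matrixP=> i j; rewrite !mxE.
rewrite /code1 /aff_ext_code_sigma /aff_ext_code /aff_code image_comp.
rewrite Hirz_codeE -/ext (lspan_image _ ext_linear) image_comp; congr lspan.
have extE m : ext (Hirz_eval alpha 'X_[m]) =
    tensor_vec (row_mx 0 (alpha_pow alpha (m (inord 1))))
               (row_mx 0 (alpha_pow alpha (m (inord 3)))).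
  rewrite Hirz_eval_mon !tensor_vecE /monvec !tr_row_mx !mul_col_row /ext block_mxKdr.
  by rewrite !trmx0 !mul0mx !mulmx0.
apply/seteqP; split=> [_ [m [m1 m2] <-]|_ [[d c] /= [dq cq] <-]].
  exists (m (inord 0), m (inord 3)) => /=; first by split; nia.
  by rewrite extE; congr (tensor_vec (row_mx 0 (alpha_pow _ _)) _); lia.
have [E0 E1 E2 E3] := mnm4E d (q - 1 - d) (q + e * d - c - b - 2) c.
exists (mnm4 d (q - 1 - d) (q + e * d - c - b - 2) c); last by rewrite /= extE E1 E3.
by rewrite /Lstar_mon E0 E1 E2 E3; split; nia.
Qed.

(** PRS_q(q-a) evaluates forms of degree q-1-a, complementary to a; by linearity [mxdot_monvec0]
    settles it on monomials. *)
Lemma PRS_dual a v d : (a <= q - 2)%N -> PRS alpha (q%:Z - a%:Z) v -> (d <= a)%N ->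
  mxdot v (monvec a d) = 0.
Proof.
move=> aq; rewrite /PRS ifF; last by apply/negbTE; lia.
rewrite ifF; last by apply/negbTE; lia.
move=> [P /= /dhomogP hP <-] da.
have [D0 DD] : subspace [set P : {mpoly F[2]} | mxdot (PRS_vec alpha P) (monvec a d) = 0].
  split=> [|k f g] /=; first by rewrite (linear_fun0 PRS_vec_linear) mxdot0l.
  by rewrite PRS_vec_linear mxdotDl => -> ->; rewrite mulr0 addr0.
rewrite (mpolyE P) big_seq.
apply: (big_ind (fun P => mxdot (PRS_vec alpha P) (monvec a d) = 0)) => [//|f g|m mP].
  by move=> Df Dg; rewrite -[f]scale1r; apply: DD.
rewrite -[_ *: _]addr0; apply: DD => //=.
have mE : mdeg m = (q - 1 - a)%N by rewrite hP //; lia.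
rewrite PRS_vec_mon mE mxdot_monvec0 //; last by lia.
by rewrite -mE mdegE (bigD1 ord_max) //= leq_addr.
Qed.

Lemma monvec_PRS a (f : nat -> F) : (a <= q - 2)%N ->
  PRS alpha (q%:Z - a%:Z) (\sum_(c < q - a) f c *: monvec (q - 1 - a) c).
Proof.
move=> aq; rewrite /PRS ifF; last by apply/negbTE; lia.
rewrite ifF; last by apply/negbTE; lia.
have -> : (`|q%:Z - a%:Z|%N.-1 = q - 1 - a)%N by lia.
pose m c : 'X_{1..2} := [multinom [tuple (q - 1 - a - c)%N; c]].
have mE c : m c ord_max = c by rewrite /m multinomE (tnth_nth 0%N).
have mdegm c : (c <= q - 1 - a)%N -> mdeg (m c) = (q - 1 - a)%N.
  move=> ca; rewrite mdegE !big_ord_recl big_ord0 /m !multinomE !(tnth_nth 0%N) /=.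
  by rewrite addn0 subnK.
exists (\sum_(c < q - a) f c *: 'X_[m c]).
  apply: rpred_sum => c _; apply: rpredZ; rewrite dhomogX; apply/eqP/mdegm.
  by have := ltn_ord c; lia.
have PRS_vecD k := PRS_vec_linear k.
apply: (big_ind2 (fun P v => PRS_vec alpha P = v)) => [|f1 v1 f2 v2 <- <-|c _].
- exact: linear_fun0 PRS_vec_linear.
- by rewrite -[f1]scale1r PRS_vecD !scale1r.
- rewrite -[_ *: _]addr0 PRS_vecD (linear_fun0 PRS_vec_linear) addr0 PRS_vec_mon mE.
  by rewrite mdegm //; have := ltn_ord c; lia.
Qed.

(** Both sides say s < d: the minimum with a is harmless because d <= a, and for s < 0 both hold
    trivially. *)
Lemma lt_stilde e a b d : (1 <= e)%N -> (d <= a)%N ->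
  (1 + stilde q e a b <= d%:Z)%R = (b < q + e * d)%N.
Proof.
move=> e1 da; rewrite /stilde /slope.
have e0 : 0 < e%:R :> rat by rewrite ltr0n.
rewrite pmulr_lge0 ?invr_gt0 // subr_ge0 ler_nat.
case: (leqP q b) => qb; last by rewrite addrN lez_nat leq0n (leq_trans qb) ?leq_addr.
have -> : (1 + Order.min (Num.floor ((b%:R - q%:R) / e%:R : rat)) a%:Z <= d%:Z) =
    (Num.floor ((b%:R - q%:R) / e%:R : rat) < d%:Z) || (a%:Z < d%:Z).
  by rewrite lez1D gt_min.
rewrite floor_lt_int ltr_pdivrMr // ltrBlDr -natrM -natrD ltr_nat.
by rewrite mulnC addnC; lia.
Qed.

End Codes.

(** * The two inclusions of the duality *)

Theorem theorem4p2 (F : finFieldType) (q : nat) (hq : #|F| = q)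
    (alpha : 'I_q -> F) (halpha : bijective alpha)
    (e a b : nat) (he : (1 <= e)%N) (ha : (a <= q - 2)%N)
    (hb : (0 <= b%:Z - e%:Z * a%:Z)%R) :
  dual_code (Hirz_code alpha e a%:Z b%:Z) =
  set_add (set_add (code1 alpha e b) (code2 alpha a)) (code3 alpha e a b).
Proof.
have eab : (e * a <= b)%N by lia.
have q_gt1 : (1 < q)%N by rewrite -hq finNzRing_gt1.
have sdual := subspace_dual (Hirz_code alpha e a%:Z b%:Z).
have led d : (d <= a)%N -> (e * d <= b)%N.
  by move=> da; rewrite (leq_trans _ eab) // leq_mul2l da orbT.
have dualP M := dual_Hirz_codeP hq alpha M eab.
have dual_tensor (u v : 'rV[F]_(1 + q)) d : (d <= a)%N ->
  (forall d', (d' <= a)%N -> mxdot u (monvec alpha a d') = - (d == d')%:R) ->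
  (forall c, (c <= b - e * d)%N -> mxdot v (monvec alpha (b - e * d) c) = 0) ->
  dual_code (Hirz_code alpha e a b) (tensor_vec u v).
  move=> da udual vdual; apply/dualP => d' c d'a cb.
  rewrite mxdot_tensor mulmx_tensor mxdotZl udual //.
  by case: eqP cb => [<- cb|_ _]; rewrite ?oppr0 ?mul0r // vdual ?mulr0.
have sub1 : code1 alpha e b `<=` dual_code (Hirz_code alpha e a b).
  rewrite (code1E hq); apply: (lspan_min sdual) => _ [[d c] /= [dq cq] <-].
  apply/dualP => d' c' d'a cb.
  rewrite mxdot_tensor mulmx_tensor mxdotZl (mxdot_alpha_pow_monvec hq) //.
  case: eqP d'a cb => [<- d'a cb|_ _ _]; last by rewrite oppr0 mul0r.
  (* For d' = d the T-exponents add up to at most q-2, so the power sum vanishes. *)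
  by rewrite (mxdot0_alpha_pow hq) ?mulr0 //; have := led _ d'a; lia.
have sub2 : code2 alpha a `<=` dual_code (Hirz_code alpha e a b).
  move=> M [rowM _]; apply/dualP => d c da cb.
  rewrite mxdot_tensor (_ : _ *m _ = 0) ?mxdot0l //; apply/rowP=> i.
  rewrite [RHS]mxE -(PRS_dual hq halpha ha (rowM i) da) mxdotC mxdot_row mxE.
  by apply: eq_bigr => j _; rewrite [X in _ * X = _]mxE [X in _ = _ * X]mxE.
have sub3 : code3 alpha e a b `<=` dual_code (Hirz_code alpha e a b).
  apply: (lspan_min sdual) => _ [d /= [sd da] <-].
  have bq : (b < q + e * d)%N by rewrite -(lt_stilde hq b he da).
  apply: (dual_tensor _ _ d) => // [d' d'a|c cb].
    by rewrite (mxdot_alpha_pow_monvec hq) //; lia.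
  (* The second factor is the top monomial of degree q-1-(b-ed), complementary to b-ed. *)
  have -> : row_mx 1%:M (alpha_pow alpha (q - 1 + e * d - b)) =
      monvec alpha (q - 1 + e * d - b) (q - 1 + e * d - b).
    by rewrite /monvec eqxx.
  by rewrite (mxdot_monvec0 hq) //; have := led _ da; lia.
apply/seteqP; split=> [M /dualP HM|]; last first.
  move=> _ [_ [x /sub1 Cx [y /sub2 Cy <-]] [z /sub3 Cz <-]].
  exact: (subspaceD sdual (subspaceD sdual Cx Cy) Cz).
pose w d := monvec alpha a d *m M^T.
have /choice[f wf] (d : 'I_a.+1) : exists f : nat -> F, w d =
    \sum_(c < q - (b - e * d)) f c *: monvec alpha (q - 1 - (b - e * d)) c.
  apply: (monvec_dual hq halpha) => c cb.
  by rewrite -mxdot_tensor; apply: HM; rewrite // -ltnS.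
pose u d : 'rV[F]_(1 + q) := row_mx 0 (alpha_pow alpha (q - 1 - d)).
pose N : 'M[F]_(1 + q) := \sum_(d < a.+1) (-1) *: tensor_vec (u d) (w d).
have [x Cx [z Cz xz]] : set_add (code1 alpha e b) (code3 alpha e a b) N.
  have s13 : subspace (set_add (code1 alpha e b) (code3 alpha e a b)).
    apply: subspace_set_add; last exact: subspace_lspan.
    by rewrite (code1E hq); apply: subspace_lspan.
  apply: subspace_sum => // d; apply: subspaceZ => //.
  have da : (d <= a)%N by rewrite -ltnS.
  have ed := led _ da.
  rewrite wf tensor_vecE linear_sum mulmx_suml.
  apply: subspace_sum => // c; rewrite linearZ -scalemxAl -tensor_vecE.
  apply: subspaceZ => //; have cq := ltn_ord c.
  (* The top monomial yields [vec_d], and the mere existence of [c] gives b < q + ed. The others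
     vanish at infinity and satisfy the bound of [code1E]. *)
  have [cn|cn] := eqVneq (c : nat) (q - 1 - (b - e * d))%N.
    exists 0; first by rewrite (code1E hq); exact: (subspace_lspan _).1.
    exists (vec_d alpha e b d); last first.
      rewrite add0r /vec_d /monvec cn eqxx.
      by rewrite (_ : q - 1 + e * d - b = q - 1 - (b - e * d))%N //; lia.
    by apply: subset_lspan; exists (d : nat) => //=; rewrite (lt_stilde hq) //; split=> //; lia.
  exists (tensor_vec (u d) (monvec alpha (q - 1 - (b - e * d)) c)).
    rewrite (code1E hq); apply: subset_lspan; exists (d : nat, c : nat) => /=.
      by split; lia.
    by rewrite /monvec (negPf cn) raddf0.
  by exists 0; [exact: (subspace_lspan _).1|rewrite addr0].
exists (x + (M - N)); last first.
  by exists z => //; rewrite -xz addrAC addrC subrK.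
exists x => //; exists (M - N) => //; split=> // i.
have [g ->] : exists g : nat -> F, row i (M - N) =
    \sum_(c < q - a) g c *: monvec alpha (q - 1 - a) c.
  apply: (monvec_dual hq halpha) => d da.
  (* Duality leaves only the d-th term, and the sign in [N] cancels that of the power sum. *)
  have wN : monvec alpha a d *m N^T = w d.
    rewrite linear_sum mulmx_sumr.
    have dlt : (d < a.+1)%N by [].
    rewrite (bigD1 (Ordinal dlt)) //= big1 ?addr0 => [|d' dd'].
      rewrite linearZ -scalemxAr mulmx_tensor (mxdot_alpha_pow_monvec hq) //.
        by rewrite eqxx scalerA mulrNN mulr1 scale1r.
      by lia.
    rewrite linearZ -scalemxAr mulmx_tensor (mxdot_alpha_pow_monvec hq) //.
      by rewrite -val_eqE /= in dd'; rewrite (negPf dd') oppr0 scale0r scaler0.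
    by have := ltn_ord d'; lia.
  transitivity ((monvec alpha a d *m (M - N)^T) 0 i).
    rewrite mxdotC mxdot_row mxE.
    by apply: eq_bigr => j _; rewrite [X in _ * X = _]mxE [X in _ = _ * X]mxE.
  by rewrite linearB /= mulmxBr wN subrr mxE.
exact: monvec_PRS.
Qed.
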